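(* Let $I,J$ be translation invariant analytic P-ideals of subsets of $\mathbb N$, with $I$ tall, and let $\vec a$ be a base sequence adapted to both $I$ and $J$. If $I$ is not included in $J$ on intervals, then $c\,I[\vec a]\not\subseteq J[\vec a]$ for every non-zero real number $c$, where $c\,X=\{cx:x\in X\}$.
   Context: $\mathbb N=\{1,2,\dots\}$; subsets of $\mathbb N$ are identified with $2^{\mathbb N}$. A base sequence is $\vec a=(a_n)$ with $a_n\in\mathbb N$, $a_n\ge2$. Every $r\in\mathbb R_{\ge0}$ has a unique representation $r=[r]+\sum_{n\ge1}\frac{r_n}{a_1\cdots a_n}$ ($[r]$ the integer part, $0\le r_n<a_n$ integers, $r_n\ne a_n-1$ for infinitely many $n$); $j_{\vec a}(r)=\{n:r_n\ne r_{n+1}\}$. An ideal is a nonempty family of subsets of $\mathbb N$ closed under finite unions and subsets and containing all singletons; translation invariant means $x\in I$ implies $\{n+1:n\in x\},\{n:n+1\in x\}\in I$. An lsc submeasure is a lower semicontinuous, monotone, subadditive $\phi:2^{\mathbb N}\to[0,\infty]$ with $0<\phi(\{n\})<\infty$ for all $n$; $\mathrm{Exh}(\phi)=\{x:\phi(x\setminus\{1,\dots,n\})\to0\}$; an analytic P-ideal is an ideal of the form $\mathrm{Exh}(\phi)$ for some lsc submeasure $\phi$. $I$ is tall if every infinite subset of $\mathbb N$ contains an infinite subset belonging to $I$. $I$ is not included in $J$ on intervals if there are lsc submeasures $\phi,\psi$ with $I=\mathrm{Exh}(\phi)$, $J=\mathrm{Exh}(\psi)$ and some $d>0$ such that $\inf\{\phi(P):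 P \text{ an interval in } \mathbb N \text{ (a set of consecutive positive integers) with } \psi(P)\ge d\}=0$. $\vec a$ is adapted to $I$ if $\{n:a_n\ne a_{n+1}\}\in I$. For such $I$, $I[\vec a]$ denotes the set $\{\pm r: r\in\mathbb R_{\ge0}, j_{\vec a}(r)\in I\}\subseteq\mathbb R$. *)

(* Defs.v *)
From HB Require Import structures.
From mathcomp Require Import all_boot all_order all_algebra.
From mathcomp Require Import all_classical all_reals all_analysis.

Set Implicit Arguments.
Unset Strict Implicit.
Unset Printing Implicit Defensive.

Import Order.TTheory GRing.Theory Num.Theory.
Import numFieldNormedType.Exports.

Local Open Scope classical_set_scope.
Local Open Scope ring_scope.

(* The index set {1, 2, ...} is relabelled as [nat] by n |-> n - 1: a position
   n : nat stands for the positive integer n + 1, so [a 0] is a_1, the product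
   a_1 ... a_(n+1) is [\prod_(i < n.+1) a i], and {1, ..., n} is [`I_n]. *)

Definition base_sequence (a : nat -> nat) : Prop := forall n, (2 <= a n)%N.

Definition is_ideal (I : set (set nat)) : Prop :=
  [/\ I !=set0,
      forall x y, I x -> I y -> I (x `|` y),
      forall x y, x `<=` y -> I y -> I x
    & forall n, I [set n]].

Definition translation_invariant (I : set (set nat)) : Prop :=
  forall x, I x -> I [set n.+1 | n in x] /\ I [set n | x n.+1].

Definition tall (I : set (set nat)) : Prop :=
  forall x, infinite_set x -> exists y, [/\ y `<=` x, infinite_set y & I y].

(* Lower semicontinuity refers to the product topology on 2^nat, carried in the
   library by [cantor_space].  [phi set0 = 0] is not required; it holds as soon
   as [Exh phi] is nonempty, by monotonicity. *)
Definition lsc_submeasure (R : realType) (phi : set nat -> \bar R) : Prop :=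
  [/\ forall x, (0 <= phi x)%E,
      forall x y, x `<=` y -> (phi x <= phi y)%E,
      forall x y, (phi (x `|` y) <= phi x + phi y)%E,
      forall n, (0 < phi [set n] < +oo)%E
    & lower_semicontinuous (fun x : cantor_space => phi [set n | x n])].

Definition Exh (R : realType) (phi : set nat -> \bar R) : set (set nat) :=
  [set x | (fun n => phi (x `\` `I_n)) @ \oo --> 0%E].

Definition analytic_P_ideal (R : realType) (I : set (set nat)) : Prop :=
  is_ideal I /\
  exists2 phi : set nat -> \bar R, lsc_submeasure phi & I = Exh phi.

Definition nat_interval (P : set nat) : Prop :=
  forall x y, P x -> P y -> forall z, (x <= z <= y)%N -> P z.

Definition not_included_on_intervals (R : realType) (I J : set (set nat)) :
    Prop :=
  exists phi psi : set nat -> \bar R,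
    [/\ lsc_submeasure phi, lsc_submeasure psi, I = Exh phi, J = Exh psi
      & exists2 d : R, 0 < d &
          ereal_inf [set phi P | P in
            [set P | nat_interval P /\ (d%:E <= psi P)%E]] = 0%E].

Definition adapted (a : nat -> nat) (I : set (set nat)) : Prop :=
  I [set n | a n != a n.+1].

(* [d] is the sequence of digits of the fractional part of [r >= 0] in base
   [a]; for a base sequence [a] it exists and is unique. *)
Definition digits_of (R : realType) (a : nat -> nat) (r : R) (d : nat -> nat) :
    Prop :=
  [/\ forall n, (d n < a n)%N,
      infinite_set [set n | d n != (a n - 1)%N]
    & series (fun n => (d n)%:R / (\prod_(i < n.+1) a i)%N%:R : R) @ \oo
        --> r - (Num.floor r)%:~R].

Definition jump_set (d : nat -> nat) : set nat := [set n | d n != d n.+1].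

Definition real_set (R : realType) (I : set (set nat)) (a : nat -> nat) :
    set R :=
  [set x | exists r : R,
     [/\ 0 <= r, x = r \/ x = - r
       & exists2 d, digits_of a r d & I (jump_set d)]].
Arguments real_set R I a : clear implicits.

(* Main.v *)
(* Non-inclusion on intervals yields a union [U] of intervals, far out and with
   summable [phi]-size but [psi]-size bounded below, so [U] is in [I] and not in
   [J].  Cut the positions into windows of a length [L] depending only on [c].
   Choose [x] with digits 0 and 1, the only possible 1 of a window meeting [U]
   being decided adaptively so that the digits of [|c| x] cannot be constant on
   that window as long as the base is constant there.  The jumps of [x] stay
   within distance [L] of [U], while [U] stays within distance [L] of the jumps
   of [|c| x] and of the base; translation invariance turns this into
   [jump_set x] in [I] and [jump_set (c x)] not in [J]. *)

Require Import Defs.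
From mathcomp Require Import all_boot all_order all_algebra.
From mathcomp Require Import all_classical all_reals all_analysis.
From mathcomp Require Import ring lra zify.

Import Order.TTheory GRing.Theory Num.Theory.
Import numFieldNormedType.Exports.

Local Open Scope classical_set_scope.
Local Open Scope ring_scope.

(** * Lower semicontinuous submeasures and the ideals [Exh phi] *)

Lemma cantor_trunc_cvg (x : cantor_space) :
  (fun k => (fun n => x n && (n < k)%N) : cantor_space) @ \oo --> x.
Proof.
apply/cvg_sup => N U [V] [[W] oW <-] WxN WU.
by exists N.+1 => // k /= Nk; apply: WU => /=; rewrite Nk andbT.
Qed.

(** The truncations of [x] converge to [x], so one of them enters the neighbourhood on which [phi]
    stays above [r]. *)
Lemma lsc_trunc (R : realType) (phi : set nat -> \bar R) (x : set nat) (r : R) :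
  lsc_submeasure phi -> (r%:E < phi x)%E ->
  exists n, (r%:E < phi (x `&` `I_n))%E.
Proof.
move=> [_ _ _ _ lsc] rx.
pose X : cantor_space := fun n => `[< x n >].
have XE : [set n | X n] = x by apply/seteqP; split=> n /asboolP.
have [|V nV Vr] := lsc X r; first by rewrite XE.
have [N _ /(_ N (leqnn N))/= VN] := cantor_trunc_cvg X V nV.
exists N; have := Vr _ VN; congr (_ < phi _)%E.
apply/seteqP; split=> n /=; first by move=> /andP[/asboolP].
by move=> [xn nN]; apply/andP; split => //; apply/asboolP.
Qed.

Lemma ExhP (R : realType) (phi : set nat -> \bar R) (x : set nat) :
  lsc_submeasure phi ->
  Exh phi x <-> forall e : R, 0 < e -> exists n, (phi (x `\` `I_n) <= e%:E)%E.
Proof.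
move=> [phi0 mono _ _ _]; split.
  move=> /fine_cvgP[[N _ fin] /cvgrPdist_le cv] e /cv[M _ ltM].
  exists (maxn N M); have /= := ltM _ (leq_maxr N M).
  rewrite sub0r normrN => /ler_normlW.
  by rewrite -lee_fin fineK// fin//= leq_maxl.
move=> small; have le_small (e : R) n m : (n <= m)%N ->
    (phi (x `\` `I_n) <= e%:E)%E -> (phi (x `\` `I_m) <= e%:E)%E.
  move=> nm; apply: le_trans; apply: mono => k [xk km].
  by split=> // kn; apply: km; apply: leq_trans nm.
apply/fine_cvgP; split.
  have [n phin] := small 1 ltr01; exists n => // m /= nm.
  rewrite ge0_fin_numE//.
  exact: le_lt_trans (le_small _ _ _ nm phin) (ltry _).
apply/cvgrPdist_le => e e0; have [n phin] := small e e0.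
exists n => // m /= nm; have phim := le_small _ _ _ nm phin.
rewrite sub0r normrN ger0_norm ?fine_ge0// -lee_fin fineK//.
by rewrite ge0_fin_numE//; apply: le_lt_trans phim (ltry _).
Qed.

(** The finite pieces [P k] lie beyond [k], with [phi] at most 2^-k and [psi] at least d/2. The
    [phi]-tails of their union are bounded by a geometric series, while every tail contains a whole
    piece. *)
Lemma interval_witness (R : realType) (phi psi : set nat -> \bar R) (d : R) :
  lsc_submeasure phi -> lsc_submeasure psi -> 0 < d ->
  ereal_inf [set phi P | P in
    [set P | nat_interval P /\ (d%:E <= psi P)%E]] = 0%E ->
  exists U : set nat, Exh phi U /\ ~ Exh psi U.
Proof.
move=> hphi hpsi d0 inf0.
have [phi0 mono sub pos _] := hphi; have [_ monos _ _ _] := hpsi.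
have infle (e : R) : 0 < e ->
    exists P, (d%:E <= psi P)%E /\ (phi P < e%:E)%E.
  rewrite -lte_fin -[X in (X < _)%E]inf0 => /ereal_inf_lt[_ [P [_ dP] <-] Pe].
  by exists P.
have phi_set0 : phi set0 = 0%E.
  apply/eqP; rewrite eq_le phi0 andbT; apply/lee_addgt0Pr => e e0.
  have [P [_ Pe]] := infle e e0; rewrite add0e.
  by apply: le_trans (ltW Pe); exact: mono.
have /choice[P hP] : forall k : nat, exists Q : set nat,
    [/\ (exists n, Q `<=` `I_n), forall n, Q n -> (k <= n)%N,
        ((d / 2)%:E <= psi Q)%E & (phi Q <= (2^-1 ^+ k)%:E)%E].
  move=> k.
  (* With [e] below [phi] of each singleton under [k], monotonicity keeps any set with [phi] below
     [e] off those positions. *)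
  have [e [e0 ek esing]] : exists e : R, [/\ 0 < e, e <= 2^-1 ^+ k &
      forall n, (n < k)%N -> (e%:E <= phi [set n])%E].
    have [e [e0 esing]] : exists e : R, 0 < e /\
        forall n, (n < k)%N -> (e%:E <= phi [set n])%E.
      elim: k => [|k [e [e0 IH]]]; first by exists 1.
      have /andP[s0 s1] := pos k.
      have sfin : phi [set k] \is a fin_num by rewrite ge0_fin_numE.
      exists (Num.min e (fine (phi [set k]))); split.
        by rewrite lt_min e0 fine_gt0// s0.
      move=> n; rewrite ltnS leq_eqVlt => /orP[/eqP ->|nk].
        by rewrite -[leRHS]fineK// lee_fin ge_min lexx orbT.
      by apply: le_trans (IH _ nk); rewrite lee_fin ge_min lexx.
    exists (Num.min e (2^-1 ^+ k)); split.
    - by rewrite lt_min e0 exprn_gt0.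
    - by rewrite ge_min lexx orbT.
    - by move=> n nk; apply: le_trans (esing _ nk); rewrite lee_fin ge_min lexx.
  have [Q [dQ Qe]] := infle e e0.
  (* Lower semicontinuity preserves only strict lower bounds, hence d/2 in place of d after
     truncation. *)
  have [N QN] : exists N, ((d / 2)%:E < psi (Q `&` `I_N))%E.
    apply: lsc_trunc => //; apply: lt_le_trans dQ; rewrite lte_fin; lra.
  exists (Q `&` `I_N); split.
  - by exists N; exact: subIsetr.
  - move=> n [Qn _]; rewrite leqNgt; apply/negP => nk.
    have := lt_le_trans Qe (esing _ nk); rewrite ltNge => /negP; apply.
    by apply: mono => m ->.
  - exact: ltW.
  - apply: le_trans (_ : phi Q <= _)%E; first by apply: mono; exact: subIsetl.
    by apply: le_trans (ltW Qe) _; rewrite lee_fin.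
pose U := \bigcup_k P k; exists U; split; last first.
  move/(ExhP _ _ _ hpsi) => /(_ (d / 4)) []; first by lra.
  move=> n; apply/negP; rewrite -ltNge.
  have [_ Pn dP _] := hP n; apply: (@lt_le_trans _ _ (d / 2)%:E).
    by rewrite lte_fin; lra.
  apply: le_trans dP _; apply: monos => m Pm; split; first by exists n.
  by apply/negP; rewrite -leqNgt; apply: Pn.
have fin_sum K j : (phi (\bigcup_(k in [set k | (K <= k < K + j)%N]) P k) <=
    (2 * 2^-1 ^+ K - 2 * 2^-1 ^+ (K + j))%:E)%E.
  elim: j => [|j IH].
    rewrite addn0 subrr (_ : \bigcup_(_ in _) _ = set0) ?phi_set0//.
    by apply/seteqP; split=> // x [k /=]; lia.
  apply: (@le_trans _ _ (phi ((\bigcup_(k in [set k | (K <= k < K + j)%N]) P k)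
     `|` P (K + j)%N))).
    apply: mono => x [k /= kK Pkx].
    have [kE|kj] := eqVneq k (K + j)%N; first by right; rewrite -kE.
    by left; exists k => //=; lia.
  apply: le_trans (sub _ _) _; have [_ _ _ lej] := hP (K + j)%N.
  apply: le_trans (leeD IH lej) _.
  by rewrite -EFinD lee_fin addnS exprS; lra.
(* Lower semicontinuity reduces this to truncations, and [I_N] meets only pieces with index below
   [N]: a finite sum. *)
have tail K : (phi (\bigcup_(k in [set k | (K <= k)%N]) P k) <=
    (2 * 2^-1 ^+ K)%:E)%E.
  rewrite leNgt; apply/negP => /(lsc_trunc _ _ _ _ hphi)[N].
  apply/negP; rewrite -leNgt.
  apply: le_trans
    (_ : (2 * 2^-1 ^+ K - 2 * 2^-1 ^+ (K + N))%:E <= _)%E; last first.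
    by rewrite lee_fin gerBl mulr_ge0// exprn_ge0.
  apply: le_trans (fin_sum K N); apply: mono => x [[k /= Kk Pkx] xN].
  by exists k => //=; have [_ /(_ _ Pkx) kx _ _] := hP k; move: xN => /=; lia.
apply/(ExhP _ _ _ hphi) => e e0.
have [K Ke] : exists K, 2 * 2^-1 ^+ K <= e.
  exists (Num.bound (2 / e)); rewrite exprVn ler_pdivrMr ?exprn_gt0//.
  by rewrite -ler_pdivrMl// mulrC; apply/ltW/upper_nthrootP.
(* The first [K] pieces are bounded, so removing a long enough initial segment leaves only later
   ones. *)
have [N hN] : exists N, forall k, (k < K)%N -> P k `<=` `I_N.
  elim: (K) => [|j [N IH]]; first by exists 0%N.
  have [[M PM] _ _ _] := hP j; exists (maxn N M) => k; rewrite ltnS leq_eqVlt.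
  move=> /orP[/eqP -> x /PM/=|kj x /(IH _ kj)/=]; lia.
exists N; apply: (@le_trans _ _ (2 * 2^-1 ^+ K)%:E); last by rewrite lee_fin.
apply: le_trans (tail K); apply: mono => x [[k _ Pkx] xN]; exists k => //=.
by rewrite leqNgt; apply/negP => kK; apply: xN; apply: hN Pkx.
Qed.

(** * Bounded thickenings in translation invariant ideals *)

Definition nbhd (L : nat) (x : set nat) : set nat :=
  [set n | exists2 m, x m & (m <= n + L)%N && (n <= m + L)%N].

(** Each unit of distance is gained by adding the two unit shifts of the previous thickening. *)
Lemma ideal_nbhd (I : set (set nat)) (L : nat) (x : set nat) :
  is_ideal I -> translation_invariant I -> I x -> I (nbhd L x).
Proof.
move=> [_ IU Isub _] tI Ix; elim: L => [|L IH].
  by apply: Isub Ix => n [m xm nm]; rewrite (_ : n = m)//; lia.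
have [Iup Idn] := tI _ IH.
apply: Isub (IU _ _ IH (IU _ _ Iup Idn)) => n [m xm nm].
case: (leqP m (n + L)) => mn; last by right; right; exists m => //; lia.
case: (leqP n (m + L)) => nmL; first by left; exists m => //; lia.
by right; left; exists n.-1; [exists m => //|]; lia.
Qed.

(** * Expansions in a base sequence *)

Section Expansions.
Variables (R : realType) (a : nat -> nat).
Hypothesis ha : base_sequence a.

Local Notation A n := ((\prod_(i < n) a i)%N%:R : R).
Local Notation S d :=
  (series (fun n => (d n)%:R / (\prod_(i < n.+1) a i)%N%:R : R)).

Lemma base_prod_gt0 (n : nat) : 0 < A n.
Proof. by rewrite ltr0n prodn_gt0// => i; have := ha i; lia. Qed.

Lemma base_prodS (n : nat) : A n.+1 = A n * (a n)%:R.
Proof. by rewrite big_ord_recr natrM. Qed.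

Lemma base_prod_const (m L : nat) :
  (forall j, (j < L)%N -> a (m + j)%N = a m) -> A (m + L) = A m * (a m)%:R ^+ L.
Proof.
elim: L => [|L IH] am; first by rewrite addn0 mulr1.
rewrite addnS base_prodS am// IH ?exprSr ?mulrA// => j jL.
by apply: am; apply: ltnW.
Qed.

Lemma base_prod_ge (m i : nat) : 2 ^+ i * A m <= A (m + i).
Proof.
elim: i => [|i IH]; first by rewrite addn0 mul1r.
rewrite addnS base_prodS exprSr mulrAC; apply: ler_pM => //.
by rewrite ler_nat.
Qed.

Lemma expansionS (d : nat -> nat) (n : nat) :
  S d n.+1 = S d n + (d n)%:R / A n.+1.
Proof. by rewrite /series/= big_nat_recr. Qed.

Lemma expansion_le (d : nat -> nat) : {homo S d : n m / (n <= m)%N >-> n <= m}.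
Proof.
apply: homo_leq => // [x y z|n]; first exact: le_trans.
by rewrite expansionS lerDl divr_ge0.
Qed.

(** Since the digit at n is at most a_n - 1, its term is at most 1/A n - 1/A (n+1), and these bounds
    telescope. *)
Lemma expansion_tail (d : nat -> nat) (N j : nat) : (forall n, (d n < a n)%N) ->
  S d (N + j)%N <= S d N + (A N)^-1 - (A (N + j))^-1.
Proof.
move=> da; elim: j => [|j IH]; first by rewrite addn0 addrK.
rewrite addnS expansionS.
have A0 := base_prod_gt0 (N + j)%N; have a2 : (0:R) < (a (N + j)%N)%:R.
  by rewrite ltr0n; have := ha (N + j)%N; lia.
have AE : (A (N + j))^-1 = (a (N + j)%N)%:R / A (N + j).+1.
  by rewrite base_prodS; field; rewrite (gt_eqF A0) (gt_eqF a2).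
have dle : (d (N + j)%N)%:R / A (N + j).+1 <=
    ((a (N + j)%N)%:R - 1) / A (N + j).+1.
  rewrite ler_pM2r ?invr_gt0 ?base_prod_gt0//.
  by rewrite lerBrDr natr1 ler_nat.
by move: IH dle; rewrite AE mulrBl mul1r; lra.
Qed.

Lemma expansion_bounds (d : nat -> nat) (s : R) (N : nat) :
  (forall n, (d n < a n)%N) ->
  S d @ \oo --> s -> S d N <= s <= S d N + (A N)^-1.
Proof.
move=> da cv; have cvd : cvgn (S d) by apply/cvg_ex; exists s.
rewrite -(cvg_lim _ cv)//; apply/andP; split.
  exact: (nondecreasing_cvgn_le (expansion_le d)).
apply: limr_le => //; exists N => // n /= Nn.
have := expansion_tail d N (n - N) da; rewrite subnKC// => /le_trans; apply.
by rewrite gerBl invr_ge0 ltW// base_prod_gt0.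
Qed.

Lemma expansion_nat (d : nat -> nat) (m : nat) :
  exists z : nat, A m * S d m = z%:R.
Proof.
elim: m => [|m [z IH]]; first by exists 0%N; rewrite /series/= big_nil mulr0.
exists (z * a m + d m)%N; rewrite expansionS mulrDr natrD natrM -IH.
rewrite [X in _ + X]mulrC divfK ?gt_eqF ?base_prod_gt0// base_prodS.
by rewrite mulrAC.
Qed.

(** A geometric sum with ratio the inverse of the common base. *)
Lemma expansion_const (d : nat -> nat) (m L : nat) :
  (forall j, (j < L)%N -> a (m + j)%N = a m) ->
  (forall j, (j < L)%N -> d (m + j)%N = d m) ->
  ((a m)%:R - 1) * A m * (S d (m + L)%N - S d m) =
  (d m)%:R * (1 - (a m)%:R ^- L).
Proof.
move=> am dm.
have a0 : (a m)%:R != 0 :> R by rewrite pnatr_eq0; have := ha m; lia.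
have A0 : A m != 0 by rewrite gt_eqF ?base_prod_gt0.
elim: L => [|L IH] in am dm *.
  by rewrite addn0 subrr mulr0 expr0 invr1 subrr mulr0.
rewrite addnS expansionS dm// addrAC mulrDr IH; first last.
- by move=> j jL; apply: dm; apply: ltnW.
- by move=> j jL; apply: am; apply: ltnW.
rewrite -addnS base_prod_const// exprS.
by field; rewrite a0 A0 expf_neq0.
Qed.

(** With b = [a m], scaling by (b - 1) * A m makes the integer part and the digits before [m]
    integral. The window contributes the integer [d m] up to [d m] * b^-L, and the later digits at
    most (b - 1) * b^-L. *)
Lemma const_window_near_int (r : R) (d : nat -> nat) (m L : nat) :
  digits_of a r d ->
  (forall j, (j < L)%N -> a (m + j)%N = a m) ->
  (forall j, (j < L)%N -> d (m + j)%N = d m) ->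
  exists z : int, `|((a m)%:R - 1) * A m * r - z%:~R| <=
    ((a m)%:R - 1) * (a m)%:R ^- L.
Proof.
move=> [da _ cv] am dm; have [u Su] := expansion_nat d m.
have /andP[lo hi] := expansion_bounds d _ (m + L)%N da cv.
have dc := expansion_const d m L am dm.
have a1 : 0 <= (a m)%:R - 1 :> R by rewrite subr_ge0 ler1n; have := ha m; lia.
have d1 : (d m)%:R <= (a m)%:R - 1 :> R by rewrite lerBrDr natr1 ler_nat.
have a0 : (0:R) < (a m)%:R by rewrite ltr0n; have := ha m; lia.
exists (((a m)%:Z - 1) * (u%:Z + (\prod_(i < m) a i)%N%:Z * Num.floor r) +
  (d m)%:Z).
set q := _ ^- L in dc *; have q0 : 0 <= q by rewrite invr_ge0 exprn_ge0.
rewrite !(rmorphD, rmorphM, rmorphN)/= -!pmulrn -Su.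
set f := (Num.floor r)%:~R in lo hi *.
pose t := A m * (r - f - S d (m + L)%N).
have t0 : 0 <= t by rewrite mulr_ge0 ?subr_ge0// ltW ?base_prod_gt0.
have tq : t <= q.
  have -> : q = A m * (A (m + L))^-1.
    by rewrite base_prod_const// invfM mulVKf// gt_eqF ?base_prod_gt0.
  by rewrite ler_pM2l ?base_prod_gt0//; lra.
(* The error is a difference of two numbers in [0, (b - 1) * q], with b = [a m]. *)
have -> : ((a m)%:R - 1) * A m * r -
   (((a m)%:R - 1) * (A m * S d m + A m * f) + (d m)%:R) =
   ((a m)%:R - 1) * t - (d m)%:R * q.
  have -> : (d m)%:R * q = (d m)%:R -
      ((a m)%:R - 1) * A m * (S d (m + L)%N - S d m).
    by rewrite dc; ring.
  by rewrite /t; ring.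
have := ler_wpM2l a1 tq; have := mulr_ge0 a1 t0.
have := ler_wpM2r q0 d1; have := mulr_ge0 (ler0n R (d m)) q0.
by rewrite ler_norml; lra.
Qed.

(* Recursion on the partial sums: the digit at [n] may depend on all earlier
   digits through [S d n]. *)
Lemma expansion_rec (f : nat -> R -> nat) :
  exists d : nat -> nat, forall n, d n = f n (S d n).
Proof.
pose X := fix X n :=
  if n is n'.+1 then X n' + (f n' (X n'))%:R / A n'.+1 else 0.
exists (fun n => f n (X n)) => n; congr f.
elim: n => [|n IH]; first by rewrite /series/= big_nil.
by rewrite expansionS -IH.
Qed.

Lemma expansion_zero_run (d : nat -> nat) (n l : nat) :
  (forall j, (j < l)%N -> d (n + j)%N = 0%N) -> S d (n + l)%N = S d n.
Proof.
elim: l => [|l IH] d0; first by rewrite addn0.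
rewrite addnS expansionS d0// mul0r addr0 IH// => j jl.
by apply: d0; apply: ltnW.
Qed.

(** The two nearby integers would satisfy z < y < z + 1. *)
Lemma near_int_gap (v h e : R) : 2 * e < h -> h + 2 * e < 1 ->
  (exists z : int, `|v - z%:~R| <= e) ->
  (exists z : int, `|v + h - z%:~R| <= e) -> False.
Proof.
move=> eh h1 [z /[!ler_norml]/andP[zl zu]] [y /[!ler_norml]/andP[yl yu]].
have : (z%:~R : R) < y%:~R by lra.
have : (y%:~R : R) < z%:~R + 1 by lra.
by rewrite -intrD1 !ltr_int; lia.
Qed.

(* Of the two choices 0, 1 for the digit at [k * L + i], one moves
   [(b - 1) * A (k * L) * c * x] away from the integers, which
   [const_window_near_int] forbids for a window of constant digits of [c * x];
   the bounds on [i] and [L] control later digits uniformly in the base [b]. *)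
Lemma exists_scaled_jumps (c : R) (i L : nat) (W : set nat) :
  0 < c -> (0 < i)%N -> (i.+1 < L)%N -> 2 * c <= 2 ^+ i ->
  4 < c * 2 ^+ (L - i.+1) ->
  exists x : R, exists d : nat -> nat,
    [/\ 0 <= x, digits_of a x d,
        forall n, d n != 0%N -> (n %% L)%N = i /\ W (n %/ L)%N
      & forall k e, W k -> digits_of a (c * x) e ->
        ~ (forall j, (j < L)%N -> a (k * L + j)%N = a (k * L)%N /\
                                 e (k * L + j)%N = e (k * L)%N)].
Proof.
move=> c0 i0 iL ci cL.
(* The tolerance is twice that of [const_window_near_int]: the second half pays for replacing [x] by
   a partial sum. A digit is 1 exactly when the sum so far is near an integer. *)
pose near_int n (s : R) := exists z : int,
  `|((a n)%:R - 1) * A (n - i) * c * s - z%:~R| <=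
  2 * (((a n)%:R - 1) * (a n)%:R ^- L).
have [d dE] := expansion_rec (fun n s =>
  `[< [/\ (n %% L)%N = i, W (n %/ L)%N & near_int n s] >] : nat).
have d_le1 n : (d n <= 1)%N by rewrite dE leq_b1.
have d_supp n : d n != 0%N ->
    [/\ (n %% L)%N = i, W (n %/ L)%N & near_int n (S d n)].
  by rewrite {1}dE eqb0 negbK => /asboolP.
have d_lt n : (d n < a n)%N by apply: leq_ltn_trans (d_le1 n) (ha n).
have d_zero n : (n %% L)%N != i -> d n = 0%N.
  by move=> ni; apply/eqP; apply: contraNT ni => /d_supp[-> _ _].
have L0 : (0 < L)%N by apply: leq_ltn_trans iL.
have [x cv] : exists x : R, S d @ \oo --> x.
  apply/(cvg_ex (S d @ \oo)).
  apply: nondecreasing_is_cvgn; first exact: expansion_le.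
  exists (S d 0%N + (A 0%N)^-1) => _ [n _ <-].
  have := expansion_tail d 0 n d_lt; rewrite add0n => /le_trans; apply.
  by rewrite gerBl invr_ge0 ltW// base_prod_gt0.
(* As [i] is positive, position 0 carries digit 0; this forces [x] below 1. *)
have S1 : S d 1%N = 0.
  rewrite /series/= big_nat1 d_zero ?mul0r// mod0n; by case: (i) i0.
have /andP[x0 x1] := expansion_bounds d x 1 d_lt cv.
rewrite S1 in x0 x1.
have x_lt1 : x < 1.
  apply: le_lt_trans x1 _; rewrite add0r invf_lt1 ?base_prod_gt0//.
  by rewrite ltr1n big_ord1; apply: ha.
have floor_x : Num.floor x = 0 by apply/eqP; rewrite floor_eq ?x0 ?add0r.
exists x, d; split => //.
- split=> //; last by rewrite floor_x subr0.
  (* The window starts [k * L] carry digit 0, which is not maximal since bases are at least 2. *)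
  set D := [set n | _] => finD; apply: infinite_nat.
  have : finite_set ((fun k : nat => (k * L)%N) @^-1` D).
    apply: finite_preimage finD => k l _ _ /eqP.
    by rewrite eqn_pmul2r// => /eqP.
  apply: sub_finite_set => k _; rewrite /D /= d_zero.
    by have := ha (k * L)%N; lia.
  by rewrite modnMl eq_sym -lt0n.
- by move=> n /d_supp[].
move=> k e Wk dig const.
pose m := (k * L)%N; pose n := (m + i)%N; pose b : R := (a m)%:R.
have am j : (j < L)%N -> a (m + j)%N = a m by move=> /const[].
have em j : (j < L)%N -> e (m + j)%N = e m by move=> /const[].
have an : a n = a m by apply: am; apply: ltnW.
have b2 : 2 <= b by rewrite ler_nat; apply: ha.
have [z hz] := const_window_near_int (c * x) e m L dig am em.
have Am0 := base_prod_gt0 m.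
(* After [n] the next possible 1 is at [n + L], so the remainder gains a factor 2^-i that absorbs
   [c]. *)
have run : S d (m + L + i)%N = S d n.+1.
  rewrite (_ : (m + L + i)%N = (n.+1 + L.-1)%N); last by rewrite /n; lia.
  apply: expansion_zero_run => j jL; apply: d_zero.
  rewrite addSnnS /n -addnA modnMDl -{2}(modn_small (ltnW iL)).
  by rewrite -[X in _ != X %[mod _]]addn0 eqn_modDl mod0n modn_small -?ltn_predRL.
have /andP[lo hi] := expansion_bounds d x (m + L + i)%N d_lt cv.
rewrite run in lo hi.
set q : R := b ^- L; have q0 : 0 < q by rewrite invr_gt0 exprn_gt0//; lra.
have tail : A m * c * (x - S d n.+1) <= q.
  have hx : x - S d n.+1 <= (2 ^+ i * (A m * b ^+ L))^-1.
    apply: (@le_trans _ _ (A (m + L + i))^-1); first by lra.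
    rewrite lef_pV2 ?posrE ?base_prod_gt0// -?base_prod_const ?base_prod_ge//.
    by rewrite mulr_gt0 ?exprn_gt0 ?base_prod_gt0.
  apply: le_trans (ler_wpM2l _ hx) _; first by rewrite mulr_ge0// ltW.
  have -> : A m * c * (2 ^+ i * (A m * b ^+ L))^-1 = c / 2 ^+ i * q.
    rewrite /q; field.
    by rewrite !expf_neq0 ?(gt_eqF Am0)// gt_eqF//; lra.
  rewrite ler_piMl ?(ltW q0)// ler_pdivrMr ?exprn_gt0// mul1r.
  by move: ci c0; lra.
have nearn1 : exists z : int,
    `|(b - 1) * A m * c * S d n.+1 - z%:~R| <= 2 * ((b - 1) * q).
  exists z; have t0 : 0 <= (b - 1) * (A m * c * (x - S d n.+1)).
    rewrite mulr_ge0 ?mulr_ge0 ?subr_ge0// ?ltW//; lra.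
  have b1 : 0 <= b - 1 by lra.
  have t1 := ler_wpM2l b1 tail.
  move: hz; rewrite !ler_norml -/b -/q.
  rewrite (_ : (b - 1) * A m * (c * x) = (b - 1) * A m * c * S d n.+1 +
    (b - 1) * (A m * c * (x - S d n.+1))); last by ring.
  by lra.
have nmod : (n %% L)%N = i by rewrite /n modnMDl modn_small// ltnW.
have ndiv : (n %/ L)%N = k by rewrite /n divnMDl// divn_small ?addn0// ltnW.
have nearE s : near_int n s <-> exists z : int,
    `|(b - 1) * A m * c * s - z%:~R| <= 2 * ((b - 1) * q).
  by rewrite /near_int an /n addnK.
(* Digit 0: the sum is unchanged and near an integer, so the rule would have chosen 1. Digit 1: the
   sum is near an integer both before and after the shift by (b - 1) * c / p. *)
have [dn0|dn0] := eqVneq (d n) 0%N.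
  move: (dn0); rewrite dE => /eqP; rewrite eqb0 => /asboolP; apply; split=> //.
    by rewrite ndiv.
  by apply/nearE; move: nearn1; rewrite expansionS dn0 mul0r addr0.
have [_ _ /nearE nearn] := d_supp _ dn0.
have dn1 : d n = 1%N by apply/eqP; rewrite eqn_leq d_le1 lt0n.
pose p := b ^+ i.+1; have p0 : 0 < p by rewrite exprn_gt0//; lra.
pose r := b ^+ (L - i.+1); have r0 : 0 < r by rewrite exprn_gt0//; lra.
have qE : q = p^-1 * r^-1 by rewrite -invfM -exprD subnKC// ltnW.
have An1 : A n.+1 = A m * p.
  by rewrite /n -addnS base_prod_const// => j ji; apply: am; apply: leq_trans (ltnW iL).
move: nearn1; rewrite expansionS dn1 mulrDr mul1r.
have -> : (b - 1) * A m * c * (A n.+1)^-1 = (b - 1) * c / p.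
  by rewrite An1; field; rewrite (gt_eqF p0) (gt_eqF Am0).
have eh : 2 * (2 * ((b - 1) * q)) < (b - 1) * c / p.
  have -> : 2 * (2 * ((b - 1) * q)) = (b - 1) / p * (4 / r) by rewrite qE; ring.
  rewrite [ltRHS]mulrAC ltr_pM2l ?divr_gt0//; last by lra.
  rewrite ltr_pdivrMr//; apply: lt_le_trans cL _.
  by rewrite ler_pM2l// lerXn2r ?nnegrE//; lra.
(* The shift is at most 1/2 and, by [eh], exceeds twice the tolerance, so [near_int_gap] applies. *)
have h1 : 2 * ((b - 1) * c / p) <= 1.
  rewrite mulrA ler_pdivrMr// mul1r /p exprS.
  have b0 : 0 <= b - 1 by lra.
  have bi : 2 * c <= b ^+ i.
    by apply: le_trans ci _; rewrite lerXn2r ?nnegrE//; lra.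
  have := ler_wpM2l b0 bi.
  have : 0 <= b ^+ i by rewrite exprn_ge0//; lra.
  by lra.
move=> nearn1.
apply: (near_int_gap _ _ _ _ _ nearn nearn1) => //.
by apply: lt_le_trans h1; rewrite [ltRHS]mulr_natl mulr2n ltrD2l.
Qed.

End Expansions.

(** * From windows to ideal membership *)

Theorem theorem3p2 (R : realType) (I J : set (set nat)) (a : nat -> nat)
    (hI : analytic_P_ideal R I) (hJ : analytic_P_ideal R J)
    (tI : translation_invariant I) (tJ : translation_invariant J)
    (tallI : tall I)
    (ha : base_sequence a) (aI : adapted a I) (aJ : adapted a J)
    (hIJ : not_included_on_intervals R I J)
    (c : R) (hc : c != 0) :
  ~ ([set c * x | x in real_set R I a] `<=` real_set R J a).
Proof.
have [idI _] := hI; have [idJ _] := hJ.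
have [phi [psi [hphi hpsi IE JE [dl dl0 inf0]]]] := hIJ.
have [U [IU JU]] := interval_witness R phi psi dl hphi hpsi dl0 inf0.
rewrite -IE in IU; rewrite -JE in JU => sub; apply: JU.
have c0 : 0 < `|c| by rewrite normr_gt0.
(* These give 2|c| <= 2^i and 4/|c| < 2^l; the successors ensure [0 < i] and [i.+1 < L]. *)
pose i := (Num.bound (2 * `|c|)).+1; pose l := (Num.bound (4 / `|c|)).+1.
pose L := (i.+1 + l)%N.
have iL : (i.+1 < L)%N by rewrite /L; lia.
have L0 : (0 < L)%N by [].
have [||x [d [x0 dig supp jumps]]] := @exists_scaled_jumps R a ha `|c| i L
  [set k | exists2 u, U u & (u %/ L)%N = k] c0 isT iL.
- by apply/ltW/upper_nthrootP.
- by rewrite /L addKn mulrC -ltr_pdivrMr//; apply: upper_nthrootP.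
(* A jump has a nonzero digit at [n] or [n.+1], in a window that meets [U]. *)
have jump_near n : jump_set d n -> nbhd L U n.
  have near_supp k : d k != 0%N ->
      exists2 u, U u & (k < u + L)%N /\ (u < k - i + L)%N.
    move=> /supp[ki [u Uu uk]]; exists u => //.
    rewrite (divn_eq k L) (divn_eq u L) ki uk addnK.
    have := ltn_pmod u L0; lia.
  have ige : (0 < i)%N by [].
  rewrite /jump_set /=; have [-> dn1|/near_supp[u Uu un] _] := eqVneq (d n) 0%N.
    have /near_supp[u Uu un] : d n.+1 != 0%N by rewrite eq_sym.
    by exists u => //; lia.
  by exists u => //; lia.
have Ix : real_set R I a x.
  exists x; split => //; [by left|exists d => //].
  have [_ _ Isub _] := idI; apply: Isub jump_near _.
  exact: ideal_nbhd.
have [|r [r0 rE [e dige Je]]] := sub (c * x); first by exists x.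
(* Both [r] and [x] are nonnegative, so the signs of [c] and of the representation drop out. *)
have {}rE : r = `|c| * x.
  rewrite -(ger0_norm r0) -(ger0_norm x0) -normrM.
  by case: rE => ->; rewrite ?normrN.
rewrite rE in dige.
have [_ JU Jsub _] := idJ.
apply: Jsub (ideal_nbhd J L _ idJ tJ (JU _ _ aJ Je)) => u Uu.
(* If [u] were far from all jumps of [a] and [e], both would be constant on its window, against
   [jumps]. *)
apply: contrapT => far; apply: (jumps (u %/ L)%N e) => //; first by exists u.
elim=> [|j IH] jL; first by rewrite addn0.
have [aj ej] := IH (ltnW jL); rewrite addnS.
suff [<- <-] : a (u %/ L * L + j)%N = a (u %/ L * L + j).+1 /\
  e (u %/ L * L + j)%N = e (u %/ L * L + j).+1 by [].
have uj : (u %/ L * L + j <= u + L)%N && (u <= u %/ L * L + j + L)%N.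
  by have := divn_eq u L; have := ltn_pmod u L0; lia.
split; apply/eqP; apply: contrapT => /negP jump; apply: far;
  exists (u %/ L * L + j)%N => //; by [left|right].
Qed.
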